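(* There is a team $X$ over the variables $\{m_1,\dots,m_4\}$ such that $X\not\models\operatorname{ncc}(m_1m_2m_3m_4)$. Furthermore, $X$ can be chosen with values in $\mathbb{R}^4$ such that for every $s\in X$ the set $\{s(m_1),\dots,s(m_4)\}$ forms an orthonormal basis of $\mathbb{R}^4$.
   Context: A (relational) team $X$ is a set of assignments $s\colon D\to A$ with a common finite domain $D$. For variables $x_1,\dots,x_k,y$: $X\models\operatorname{nc}(x_1\dots x_k,y)$ iff for all $s,t\in X$ with $t(y)\in\{s(x_1),\dots,s(x_k)\}$ it holds that $s(y)=t(y)$. The non-contextual choice atom is defined by $\operatorname{ncc}(x_1\dots x_k):=\exists y\big(\bigvee_{i=1}^k y=x_i\land\operatorname{nc}(x_1\dots x_k,y)\big)$, evaluated in team semantics: $X\models\exists y\,\phi$ iff $\{s[y\mapsto a]:s\in X,a\in F(s)\}\models\phi$ for some $F\colon X\to\mathcal P(A)\setminus\{\emptyset\}$; $X\models\phi_1\lor\phi_2$ iff $X=X_1\cup X_2$ with $X_i\models\phi_i$; $X\models\phi_1\land\phi_2$ iff both hold; for a first-order atom, $X\models y=x_i$ iff $s(y)=s(x_i)$ for all $s\in X$. (Intuitively: one can select for each $s\in X$ an element among $s(x_1),\dots,s(x_k)$ such that an element selected in some assignment is selected in every assignment in which it appears.) *)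

(* Defs.v *)
From mathcomp Require Export all_boot all_order all_algebra.
From mathcomp Require Export finmap.
From mathcomp Require Export boolp classical_sets reals.

Set Implicit Arguments.
Unset Strict Implicit.
Unset Printing Implicit Defensive.

Import GRing.Theory.
Local Open Scope fset_scope.
Local Open Scope fmap_scope.
Local Open Scope classical_set_scope.

Definition var := nat.

Definition assignment (A : Type) := {fmap var -> A}.

Definition team (A : Type) := set (assignment A).

Definition team_over (A : Type) (D : {fset var}) (X : team A) : Prop :=
  forall s, X s -> domf s = D.

Inductive formula : Type :=
| FEq of var & var
| FNc of seq var & var
| FAnd of formula & formula
| FOr of formula & formula
| FEx of var & formula.

(* The team {s[y |-> a] : s in X, a in F(s)}. Only the values of F on X are
   used. *)
Definition supplement (A : Type) (X : team A) (y : var)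
    (F : assignment A -> set A) : team A :=
  [set t | exists s, exists a, [/\ X s, F s a & t = s.[y <- a]]].

(* Lax team semantics. The value s(x) is rendered by the partial lookup
   [s.[? x]], so the clauses have their intended meaning on teams whose domain
   contains the free variables of the formula. *)
Fixpoint sat (A : Type) (X : team A) (phi : formula) {struct phi} : Prop :=
  match phi with
  | FEq y x => forall s, X s -> s.[? y] = s.[? x]
  | FNc xs y =>
      forall s t, X s -> X t ->
        (exists2 x, x \in xs & t.[? y] = s.[? x]) -> s.[? y] = t.[? y]
  | FAnd phi1 phi2 => sat X phi1 /\ sat X phi2
  | FOr phi1 phi2 =>
      exists X1 X2, [/\ X = X1 `|` X2, sat X1 phi1 & sat X2 phi2]
  | FEx y psi =>
      exists F : assignment A -> set A,
        (forall s, X s -> F s !=set0) /\ sat (supplement X y F) psi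
  end.

Definition fresh (xs : seq var) : var := (foldr maxn 0 xs).+1.

(* The variables x_1 ... x_k (k >= 1) are given as the head x and the tail xs,
   so that the disjunction is never empty; the bound variable y is chosen
   distinct from all of them. *)
Definition ncc (x : var) (xs : seq var) : formula :=
  let y := fresh (x :: xs) in
  FEx y (FAnd (foldl FOr (FEq y x) [seq FEq y x' | x' <- xs])
              (FNc (x :: xs) y)).

Definition dotv (R : realType) (n : nat) (u v : 'rV[R]_n) : R :=
  (\sum_(i < n) u 0 i * v 0 i)%R.

Definition orthonormal_basis (R : realType) (n : nat) (B : {fset 'rV[R]_n}) :=
  [/\ forall u, u \in B -> dotv u u = 1%R,
      forall u v, u \in B -> v \in B -> u != v -> dotv u v = 0%R
    & basis_of {:'rV[R]_n} (enum_fset B)].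

(* Main.v *)
Require Import Defs.

(** The Kochen-Specker argument with the 18 rays of Cabello, Estebaranz and
    Garcia-Alcaine. There are nine orthogonal bases of R^4, formed by 18 rays
    each of which lies in exactly two of them. A non-contextual choice would
    mark a set of rays meeting every basis in exactly one element; counting
    the marked rays over all bases gives the odd number 9, while each ray is
    counted twice. *)

Set Implicit Arguments.
Unset Strict Implicit.
Unset Printing Implicit Defensive.

Import Order.TTheory GRing.Theory Num.Theory.
Local Open Scope ring_scope.

Lemma leq_foldr_maxn (xs : seq nat) (x : nat) :
  x \in xs -> (x <= foldr maxn 0 xs)%N.
Proof.
elim: xs => //= z xs IH; rewrite inE leq_max => /orP[/eqP->|/IH->].
  by rewrite leqnn.
by rewrite orbT.
Qed.

Lemma fresh_notin (xs : seq var) : fresh xs \notin xs.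
Proof. by apply/negP => /leq_foldr_maxn; rewrite ltnn. Qed.

Lemma sat_or_eq (A : Type) (X : team A) (y x : var) (xs : seq var) :
  sat X (foldl FOr (FEq y x) [seq FEq y x' | x' <- xs]) ->
  forall s, X s -> exists2 x', x' \in x :: xs & s.[? y]%fmap = s.[? x']%fmap.
Proof.
(* [foldl] nests the disjunction to the left, so the outermost disjunct belongs to the last
   variable; hence induction from the end. *)
elim/last_ind: xs X => [|xs z IH] X.
  by move=> /= eqX s Xs; exists x; [rewrite mem_head | apply: eqX].
rewrite map_rcons foldl_rcons => -[X1 [X2 [-> sat1 sat2]]] s [X1s|X2s].
  have [x' x'_in eqx'] := IH _ sat1 s X1s.
  by exists x'; rewrite // -rcons_cons mem_rcons inE x'_in orbT.
by exists z; [rewrite -rcons_cons mem_rcons mem_head | apply: sat2].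
Qed.

(** [C] collects all values taken by the bound variable across the supplemented team, so it no
    longer depends on the assignment. The function [g] turns the partial lookups into actual
    values. *)
Lemma sat_ncc_choice (A : Type) (X : team A) (x : var) (xs : seq var) :
  sat X (ncc x xs) ->
  exists C : A -> Prop, forall (s : assignment A) (g : var -> A), X s ->
    (forall z, z \in x :: xs -> s.[? z]%fmap = Some (g z)) ->
    exists z, [/\ z \in x :: xs, C (g z) &
      forall z', z' \in x :: xs -> C (g z') -> g z' = g z].
Proof.
rewrite /ncc; set y := fresh _ => -[F [Fne [Hor Hnc]]].
have neq_y z : z \in x :: xs -> (z == y) = false.
  move=> z_in; apply: contraNF (fresh_notin (x :: xs)) => /eqP zy.
  by rewrite -/y -zy.
exists (fun a => exists2 t, supplement X y F t & t.[? y]%fmap = Some a).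
move=> s g Xs sg; have [a Fa] := Fne s Xs.
have Xt : supplement X y F s.[y <- a]%fmap by exists s, a.
have [z z_in] := sat_or_eq Hor Xt.
rewrite !fnd_set eqxx neq_y // sg // => -[eq_a].
exists z; split => //.
  by exists s.[y <- a]%fmap; rewrite // fnd_set eqxx eq_a.
move=> z' z'_in [t Xt' ty].
(* If [g z'] is selected in some [t], then [t] and the extension of [s] fall under the [nc] atom,
   witnessed by [z']. *)
have: s.[y <- a].[? y]%fmap = t.[? y]%fmap.
  by apply: Hnc => //; exists z' => //; rewrite fnd_set neq_y // sg.
by rewrite fnd_set eqxx ty eq_a => -[].
Qed.

Section BasisTeam.

Variables (A : Type) (T : eqType) (t0 : T) (f : T -> A) (ms : seq var).

(** Bases are lists of labels in [T], realised in [A] by [f], so that the combinatorics can be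
    computed on labels. The default [t0] is never reached when [m] lies in [ms] and [b] is as long
    as [ms]. *)
Definition entry (b : seq T) (m : var) : T := nth t0 b (index m ms).

Definition assign (b : seq T) : assignment A :=
  [fmap m : [fset m in ms]%fset => f (entry b (val m))]%fmap.

Definition basis_team (bs : seq (seq T)) : team A :=
  fun s => exists2 b, b \in bs & s = assign b.

Lemma fnd_assign (b : seq T) (m : var) :
  m \in ms -> (assign b).[? m]%fmap = Some (f (entry b m)).
Proof.
move=> m_in; have m_dom : m \in domf (assign b) by rewrite /= inE.
by rewrite in_fnd ffunE.
Qed.

Lemma entry_in (b : seq T) (m : var) :
  size b = size ms -> m \in ms -> entry b m \in b.
Proof. by move=> sz m_in; rewrite mem_nth // sz index_mem. Qed.

Lemma entry_surj (b : seq T) (w : T) :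
  uniq ms -> size b = size ms -> w \in b -> exists2 m, m \in ms & entry b m = w.
Proof.
move=> ums sz w_in; have lt_i : (index w b < size ms)%N by rewrite -sz index_mem.
exists (nth 0%N ms (index w b)); first exact: mem_nth.
by rewrite /entry index_uniq // nth_index.
Qed.

End BasisTeam.

Lemma mem_codomf_assign (A : choiceType) (T : eqType) (t0 : T) (f : T -> A)
    (ms : seq var) (b : seq T) :
  uniq ms -> size b = size ms -> codomf (assign t0 f ms b) =i map f b.
Proof.
move=> ums sz a; apply/codomfP/mapP => [[m]|[w w_in ->]].
  have [m_in|m_out] := boolP (m \in ms).
    rewrite fnd_assign // => -[<-]; exists (entry t0 ms b m) => //.
    exact: entry_in.
  by rewrite not_fnd //= ?inE ?m_out.
have [m m_in <-] := entry_surj t0 ums sz w_in.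
by exists m; rewrite fnd_assign.
Qed.

Lemma basis_team_choice (A : Type) (T : eqType) (t0 : T) (f : T -> A)
    (x : var) (xs : seq var) (bs : seq (seq T)) :
  uniq (x :: xs) ->
  (forall b, b \in bs ->
    [/\ size b = (size xs).+1, uniq b & {in b &, injective f}]) ->
  sat (basis_team t0 f (x :: xs) bs) (ncc x xs) ->
  exists c : pred T, forall b, b \in bs -> count c b = 1%N.
Proof.
move=> ums bsP /sat_ncc_choice [C HC].
(* A label is marked when its value is selected; injectivity of [f] on [b] later turns equal values
   into equal labels. *)
exists (fun w => `[< C (f w) >]) => b b_in; have [sz ub finj] := bsP b b_in.
have [] := HC (assign t0 f (x :: xs) b) (f \o entry t0 (x :: xs) b).
- by exists b.
- by move=> z z_in; rewrite fnd_assign.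
move=> z [z_in Cz Hz]; set w := entry t0 (x :: xs) b z in Cz Hz.
have w_in : w \in b by apply: entry_in.
transitivity (count (pred1 w) b); last by rewrite count_uniq_mem // w_in.
apply: eq_in_count => w' w'_in /=; apply/asboolP/eqP => [Cw'|-> //].
apply: finj => //; have [m m_in def_w'] := entry_surj t0 ums sz w'_in.
by rewrite -def_w'; apply: Hz => //=; rewrite def_w'.
Qed.

Lemma odd_bases_no_choice (T : eqType) (bs : seq (seq T)) (r : seq T)
    (c : pred T) :
  odd (size bs) -> perm_eq (flatten bs) (r ++ r) ->
  ~ forall b, b \in bs -> count c b = 1%N.
Proof.
(* The total number of marks is the double of [count c r], hence even. *)
move=> odd_bs /permP /(_ c); rewrite count_cat addnn count_flatten => eq2 c1.
have eq1 : map (count c) bs = nseq (size bs) 1%N.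
  rewrite -(size_map (count c)); apply/all_pred1P/allP => _ /mapP[b b_in ->].
  by rewrite /= c1.
by move: odd_bs; rewrite -[size bs]mul1n -sumn_nseq -eq1 eq2 odd_double.
Qed.

Section Dot.

Variables (R : realType) (n : nat).
Implicit Types u v : 'rV[R]_n.

Lemma dotvZ (a b : R) u v : dotv (a *: u) (b *: v) = a * b * dotv u v.
Proof.
by rewrite /dotv mulr_sumr; apply: eq_bigr => i _; rewrite !mxE mulrACA.
Qed.

Lemma dotv_suml (I : Type) (r : seq I) (k : I -> R) (x : I -> 'rV[R]_n) v :
  dotv (\sum_(i <- r) k i *: x i) v = \sum_(i <- r) k i * dotv (x i) v.
Proof.
elim: r => [|i r IH].
  by rewrite !big_nil /dotv big1 // => j _; rewrite mxE mul0r.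
rewrite !big_cons -IH /dotv mulr_sumr -big_split /=; apply: eq_bigr => j _.
by rewrite !mxE mulrDl mulrA.
Qed.

(** Pairing a vanishing combination with the [i]-th vector leaves only the coefficient [k i]. *)
Lemma orthonormal_free (s : seq 'rV[R]_n) :
  uniq s -> {in s &, forall u v, dotv u v = (u == v)%:R} -> free s.
Proof.
move=> us son; rewrite -[s]/(tval (in_tuple s)); apply/freeP => k k0 i.
have : dotv (\sum_(j < size s) k j *: (in_tuple s)`_j) s`_i = 0.
  by rewrite k0 /dotv big1 // => j _; rewrite mxE mul0r.
rewrite dotv_suml (bigD1 i) //= son ?mem_nth // eqxx mulr1 big1 ?addr0 //.
move=> j ji; rewrite son ?mem_nth // nth_uniq //.
by rewrite -[_ == _ :> nat]/(j == i) (negPf ji) mulr0.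
Qed.

Lemma orthonormal_basisP (B : {fset 'rV[R]_n}) :
  size (enum_fset B) = n ->
  {in B &, forall u v, dotv u v = (u == v)%:R} -> orthonormal_basis B.
Proof.
move=> szB onB; split.
- by move=> u uB; rewrite onB // eqxx.
- by move=> u v uB vB /negPf uv; rewrite onB // uv.
(* Spanning follows by counting dimensions, so only freeness remains. *)
- rewrite basisEfree subvf dimvf /= szB /dim /= mul1n leqnn andbT.
  by apply: orthonormal_free; rewrite ?fset_uniq.
Qed.

End Dot.

(** Integer representatives make orthogonality decidable by computation; square roots enter only
    through [unitv]. *)
Definition idot (u v : seq int) : int :=
  u`_0 * v`_0 + u`_1 * v`_1 + u`_2 * v`_2 + u`_3 * v`_3.

Definition unitv (R : realType) (w : seq int) : 'rV[R]_4 :=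
  (Num.sqrt (idot w w)%:~R)^-1 *: \row_i (w`_i)%:~R.

Lemma dotv_unitv (R : realType) (u v : seq int) :
  dotv (unitv R u) (unitv R v) =
  (Num.sqrt (idot u u)%:~R)^-1 * (Num.sqrt (idot v v)%:~R)^-1 * (idot u v)%:~R.
Proof.
rewrite dotvZ; congr (_ * _); rewrite /dotv !big_ord_recr big_ord0 /= !mxE /=.
by rewrite add0r /idot !rmorphD !rmorphM.
Qed.

Definition orthogonal_rays (b : seq (seq int)) : bool :=
  all (fun u => (0 < idot u u) && all (fun v => (u != v) ==> (idot u v == 0)) b) b.

Lemma unitv_orthonormal (R : realType) (b : seq (seq int)) :
  orthogonal_rays b ->
  {in b &, forall u v, dotv (unitv R u) (unitv R v) = (u == v)%:R}.
Proof.
move=> /allP bP u v /bP/andP[u_gt0 /allP uP] /uP.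
rewrite dotv_unitv; have [<- _|_ /= /eqP ->] := eqVneq u v; last by rewrite mulr0.
have u_gt0R : 0 < (idot u u)%:~R :> R by rewrite ltr0z.
rewrite -invfM -expr2 sqr_sqrtr ?ltW // mulVf //; exact: lt0r_neq0.
Qed.

(** Distinct rays of [b] with the same image would have dot product both 0 and 1. *)
Lemma unitv_inj (R : realType) (b : seq (seq int)) :
  orthogonal_rays b -> {in b &, injective (unitv R)}.
Proof.
move=> ob u v ub vb uv; apply/eqP; have := unitv_orthonormal R ob ub vb.
rewrite uv (unitv_orthonormal R ob vb vb) eqxx; case: (u == v) => // /eqP.
by rewrite oner_eq0.
Qed.

(** A ray has the same integer representative, sign included, in both of its bases, so equality of
    labels detects shared rays. *)
Definition cabello_bases : seq (seq (seq int)) :=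
  [:: [:: [:: 0; 0; 0; 1]; [:: 0; 0; 1; 0]; [:: 1; 1; 0; 0]; [:: 1; -1; 0; 0]];
      [:: [:: 0; 0; 0; 1]; [:: 0; 1; 0; 0]; [:: 1; 0; 1; 0]; [:: 1; 0; -1; 0]];
      [:: [:: 1; -1; 1; -1]; [:: 1; -1; -1; 1]; [:: 1; 1; 0; 0]; [:: 0; 0; 1; 1]];
      [:: [:: 1; -1; 1; -1]; [:: 1; 1; 1; 1]; [:: 1; 0; -1; 0]; [:: 0; 1; 0; -1]];
      [:: [:: 0; 0; 1; 0]; [:: 0; 1; 0; 0]; [:: 1; 0; 0; 1]; [:: 1; 0; 0; -1]];
      [:: [:: 1; -1; -1; 1]; [:: 1; 1; 1; 1]; [:: 1; 0; 0; -1]; [:: 0; 1; -1; 0]];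
      [:: [:: 1; 1; -1; 1]; [:: 1; 1; 1; -1]; [:: 1; -1; 0; 0]; [:: 0; 0; 1; 1]];
      [:: [:: 1; 1; -1; 1]; [:: -1; 1; 1; 1]; [:: 1; 0; 1; 0]; [:: 0; 1; 0; -1]];
      [:: [:: 1; 1; 1; -1]; [:: -1; 1; 1; 1]; [:: 1; 0; 0; 1]; [:: 0; 1; -1; 0]]].

Lemma cabello_bases_orthogonal (b : seq (seq int)) :
  b \in cabello_bases -> [/\ size b = 4%N, uniq b & orthogonal_rays b].
Proof.
have: all (fun b => [&& size b == 4, uniq b & orthogonal_rays b]) cabello_bases.
  by vm_compute.
by move=> /allP bP /bP /and3P[/eqP].
Qed.

Lemma cabello_bases_twice :
  perm_eq (flatten cabello_bases)
    (undup (flatten cabello_bases) ++ undup (flatten cabello_bases)).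
Proof. by vm_compute. Qed.

(* [codomf s] is the set of values of s, that is, {s(m1), ..., s(m4)} for an
   assignment s with domain {m1, ..., m4}. *)
Theorem theorem7p7 (R : realType) (m1 m2 m3 m4 : var)
    (m_distinct : uniq [:: m1; m2; m3; m4]) :
  (exists (A : Type) (X : team A),
      team_over [fset m1; m2; m3; m4]%fset X /\
      ~ sat X (ncc m1 [:: m2; m3; m4])) /\
  (exists X : team 'rV[R]_4,
      [/\ team_over [fset m1; m2; m3; m4]%fset X,
          ~ sat X (ncc m1 [:: m2; m3; m4])
        & forall s, X s -> orthonormal_basis (codomf s)]).
Proof.
pose ms := [:: m1; m2; m3; m4].
pose X := basis_team [::] (unitv R) ms cabello_bases.
have X_over : team_over [fset m1; m2; m3; m4]%fset X.
  by move=> s [b _ ->]; apply/fsetP => m; rewrite !inE orbF !orbA.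
have X_nsat : ~ sat X (ncc m1 [:: m2; m3; m4]).
  move=> /(basis_team_choice m_distinct) [|c].
    move=> b /cabello_bases_orthogonal [sz ub ob]; split => //.
    exact: unitv_inj.
  exact: odd_bases_no_choice cabello_bases_twice.
split; first by exists 'rV[R]_4, X.
exists X; split => // s [b /cabello_bases_orthogonal [sz ub ob] ->].
have memB := mem_codomf_assign [::] (unitv R) m_distinct sz.
apply: orthonormal_basisP.
  (* The enumeration of [codomf] has its own order, so it is compared with the image of [b] up to
     permutation; injectivity of [unitv R] on [b] excludes repetitions. *)
  rewrite -[RHS]sz -(size_map (unitv R)); apply/perm_size/uniq_perm => //.
  by rewrite map_inj_in_uniq //; apply: unitv_inj.
move=> u v; rewrite !memB => /mapP[w wb ->] /mapP[w' w'b ->].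
by rewrite (unitv_orthonormal R ob) // (inj_in_eq (unitv_inj ob)).
Qed.
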